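(* Let $H$ be a graph and $\sigma:E(H)\to SI_5$ a capacity function on $H$. Suppose that $P$ is a path in $H$ with $\sigma(e)=(4,1)$ for every $e\in E(P)$. Assume that each internal vertex of $P$ has degree $3$ in $H$ and that $\sigma(e)\subseteq(1,4)$ for every edge $e\notin E(P)$ incident to an internal vertex of $P$. If two internal vertices of $P$ at even distance on $P$ are adjacent, i.e. there exists an edge $e$ not in $P$ connecting two internal vertices of $P$ and forming an odd cycle with the edges of $P$, then $\Phi_c(G)\ge 5$ for all $G\in H^\sigma$.
   Context: Graphs are finite and may have multiple edges. Circular flow number: for real $r\ge 2$, a circular nowhere-zero $r$-flow in a graph $G$ is an orientation of $G$ together with a real-valued flow (inflow equals outflow at every vertex) such that the value on each edge lies in $[1,r-1]$. The circular flow number $\Phi_c(G)$ is the infimum of the reals $r$ such that $G$ has a circular nowhere-zero $r$-flow ($+\infty$ if there is none). Intervals: $\mathbb{R}/5\mathbb{Z}$ is viewed as a circle of length $5$. For $a\neq b$ in $\mathbb{R}/5\mathbb{Z}$, $(a,b)$ denotes the open arc traversed clockwise (increasing direction) from $a$ to $b$, and $(x,x)=\mathbb{R}/5\mathbb{Z}\setminus\{x\}$; for instance $(4,1)$ is the open arc of length $2$ containing $0$. $I_5$ is the set of all $(a,b)$ with $a,b$ integers modulo $5$. A set $X\subseteq\mathbb{R}/5\mathbb{Z}$ is symmetric if $x\in X\iff -x\in X$. $SI_5$ is the family of all symmetric subsets of $\mathbb{R}/5\mathbb{Z}$ that are unions of (possibly no) elements of $I_5$. Generalised edges: a generalised edge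 $G_{xy}$ is a graph $G$ with at least two vertices together with two distinct vertices $x,y$, its terminals. $G_{xy}^+$ is obtained from $G_{xy}$ by adding a new edge $e^+=xy$. The open $5$-capacity is $CP_5(G_{xy})=\{f(e^+): f \text{ is a modulo-}5\text{ flow in } G_{xy}^+ \text{ (for some orientation) with } f(e)\in(1,4) \text{ for every } e\in E(G)\}$, where a modulo-$5$ flow takes values in $\mathbb{R}/5\mathbb{Z}$ and satisfies conservation modulo $5$ at every vertex. It is always an element of $SI_5$. For $A\in SI_5$, an $A$-edge is a generalised edge with $CP_5=A$ (a single ordinary edge is a $(1,4)$-edge). Families: for a graph $H$ and a capacity function $\sigma:E(H)\to SI_5$, $H^\sigma$ is the family of all graphs obtained from $H$ by replacing every edge $uv$ by a $\sigma(uv)$-edge with terminals $u$ and $v$ (the replacing generalised edges being disjoint from each other except possibly at terminals). *)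

(* Defs.v *)
From HB Require Import structures.
From mathcomp Require Import all_boot all_order all_algebra.
From mathcomp Require Import generic_quotient ring_quotient.
From mathcomp Require Import classical_sets reals ereal.

Set Implicit Arguments.
Unset Strict Implicit.
Unset Printing Implicit Defensive.

Import Order.TTheory GRing.Theory Num.Theory.

Local Open Scope classical_set_scope.
Local Open Scope ring_scope.

(* Graphs are undirected: [src] and [tgt] only name the two ends of an edge, in
   an order that no definition below depends on up to isomorphism. *)
Record mgraph := MGraph {
  vert : finType;
  edge : finType;
  src : edge -> vert;
  tgt : edge -> vert
}.
Arguments src {_} _.
Arguments tgt {_} _.

Definition joins (G : mgraph) (e : edge G) (u v : vert G) : Prop :=
  (src e = u /\ tgt e = v) \/ (src e = v /\ tgt e = u).

Definition incident (G : mgraph) (e : edge G) (v : vert G) : Prop :=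
  src e = v \/ tgt e = v.

(* A loop at [v] counts twice. *)
Definition degree (G : mgraph) (v : vert G) : nat :=
  (#|[set e : edge G | src e == v]%SET| + #|[set e : edge G | tgt e == v]%SET|)%N.

Definition isomorphic (G1 G2 : mgraph) : Prop :=
  exists (f : vert G1 -> vert G2) (g : edge G1 -> edge G2),
    [/\ bijective f, bijective g &
        forall e, joins (g e) (f (src e)) (f (tgt e))].

(* The path v_0 e_0 v_1 e_1 ... e_(n-1) v_n, with pairwise distinct vertices. *)
Record gpath (G : mgraph) := GPath {
  plen : nat;
  pvert : 'I_plen.+1 -> vert G;
  pedge : 'I_plen -> edge G;
  pvert_inj : injective pvert;
  pedge_joins : forall i : 'I_plen,
    joins (pedge i) (pvert (widen_ord (leqnSn plen) i)) (pvert (lift ord0 i))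
}.
Arguments pvert {G} _ _.
Arguments pedge {G} _ _.

Definition in_path (G : mgraph) (P : gpath G) (e : edge G) : Prop :=
  exists i, pedge P i = e.

Definition internal (G : mgraph) (P : gpath G) (i : 'I_(plen P).+1) : Prop :=
  (0 < i < plen P)%N.
Arguments internal {G} P i.

(* [o e] says whether [e] is directed from [tgt e] to [src e]. *)
Definition orientation (G : mgraph) := edge G -> bool.

Definition edge_tail (G : mgraph) (o : orientation G) (e : edge G) : vert G :=
  if o e then tgt e else src e.

Definition edge_head (G : mgraph) (o : orientation G) (e : edge G) : vert G :=
  if o e then src e else tgt e.

Definition is_flow (A : zmodType) (G : mgraph) (o : orientation G)
    (f : edge G -> A) : Prop :=
  forall v : vert G,
    \sum_(e : edge G | edge_head o e == v) f e =
    \sum_(e : edge G | edge_tail o e == v) f e.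

Definition has_circular_nzflow (R : realType) (G : mgraph) (r : R) : Prop :=
  exists (o : orientation G) (f : edge G -> R),
    is_flow o f /\ forall e, 1 <= f e <= r - 1.

(* The infimum of the empty set is +oo. *)
Definition circular_flow_number (R : realType) (G : mgraph) : \bar R :=
  ereal_inf [set r%:E | r in [set r : R | 2 <= r /\ has_circular_nzflow G r]].

Definition fiveZ (R : realType) : {pred R} := [pred x : R | x / 5 \is a Num.int].

Lemma fiveZ_zmod_closed (R : realType) : zmod_closed (@fiveZ R).
Proof.
by split=> [|x y]; rewrite !inE ?mul0r ?rpred0 // mulrBl; apply: rpredB.
Qed.

HB.instance Definition _ (R : realType) :=
  GRing.isZmodClosed.Build R (@fiveZ R) (@fiveZ_zmod_closed R).

Definition circle (R : realType) : zmodType :=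
  Quotient.quot (@fiveZ R : zmodClosed R).

Definition mod5 (R : realType) (x : R) : circle R :=
  (\pi_(Quotient.quot (@fiveZ R : zmodClosed R)) x)%qT.

(* For a <> b, the open arc from a to b is the image of ]s, t[ for any lifts
   s of a and t of b with s < t < s + 5. *)
Definition open_arc (R : realType) (a b : circle R) : set (circle R) :=
  if a == b then ~` [set a]
  else [set z | exists s x t : R,
         [/\ mod5 s = a, mod5 t = b, mod5 x = z, t < s + 5 & s < x < t]].

Definition I5 (R : realType) : set (set (circle R)) :=
  [set X | exists m n : int, X = open_arc (mod5 m%:~R) (mod5 n%:~R)].

Definition symmetric_set (R : realType) (X : set (circle R)) : Prop :=
  forall x, X x <-> X (- x).

Definition SI5 (R : realType) : set (set (circle R)) :=
  [set X | symmetric_set X /\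
     exists2 F : set (set (circle R)), F `<=` @I5 R & X = \bigcup_(Y in F) Y].

Definition arc14 (R : realType) : set (circle R) := open_arc (mod5 1) (mod5 4).
Definition arc41 (R : realType) : set (circle R) := open_arc (mod5 4) (mod5 1).

Record gedge := GEdge {
  ggraph :> mgraph;
  term1 : vert ggraph;
  term2 : vert ggraph;
  term_neq : term1 != term2
}.

(* The new edge is [None]. *)
Definition plus_graph (K : gedge) : mgraph :=
  @MGraph (vert K) (option (edge K))
    (fun e => if e is Some e' then src e' else term1 K)
    (fun e => if e is Some e' then tgt e' else term2 K).

Definition open_capacity (R : realType) (K : gedge) : set (circle R) :=
  [set c | exists (o : orientation (plus_graph K))
                  (f : edge (plus_graph K) -> circle R),
     [/\ is_flow o f, forall e : edge K, arc14 (f (Some e)) & f None = c]].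

Arguments open_capacity : clear implicits.

Section Replace.
Variables (H : mgraph) (K : edge H -> gedge).

Definition inner_vert (e : edge H) : finType :=
  {v : vert (K e) | (v != term1 (K e)) && (v != term2 (K e))}.

Definition rvert : finType := (vert H + {e : edge H & inner_vert e})%type.

Definition redge : finType := {e : edge H & edge (K e)}.

Definition remb (e : edge H) (v : vert (K e)) : rvert :=
  match insub v : option (inner_vert e) with
  | Some w => inr (Tagged inner_vert w)
  | None => inl (if v == term1 (K e) then src e else tgt e)
  end.

(* The graph obtained from [H] by replacing each edge [e] by a copy of [K e]
   whose terminals are identified with [src e] and [tgt e]. *)
Definition replace_edges : mgraph :=
  @MGraph rvert redge
    (fun k => remb (src (tagged k)))
    (fun k => remb (tgt (tagged k))).

End Replace.

(* Exchanging the terminals of a generalised edge gives a generalised edge with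
   the same capacity, so both ways of placing it on an edge of [H] are covered. *)
Definition replacement_family (R : realType) (H : mgraph)
    (sigma : edge H -> set (circle R)) (G : mgraph) : Prop :=
  exists2 K : edge H -> gedge,
    forall e, open_capacity R (K e) = sigma e & isomorphic (replace_edges K) G.

(* Main.v *)
From HB Require Import structures.
Require Import Defs.
From mathcomp Require Import all_boot all_order all_algebra.
From mathcomp Require Import classical_sets reals ereal.
From mathcomp Require Import generic_quotient ring_quotient zify lra.

(** Suppose that [G] has a circular nowhere-zero [r]-flow with [r < 5]. All its
values lie in [[1, r - 1]], so a scaling by a factor slightly larger than [1]
gives a real flow with values strictly between [1] and [4]
([circular_flow_lt5]). Contracting each generalised edge to the edge of [H] it
replaces, and sending along that edge the net amount that enters through one
terminal and leaves through the other, gives a real flow [c] on [H]; reduced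
modulo [5], the value [c e] belongs to the capacity of [e]
([contract_flow]).

Follow [c] along [P]. Modulo [5], each path edge carries an amount in
[(-1, 1)]. At an internal vertex with incoming amount [x] and outgoing amount
[y], the only other edge carries [x - y], which lies in [(-2, 2)] and, modulo
[5], in [(1, 4)]. So [x - y] is in [(1, 2)] or in [(-2, -1)]
([arc14_sub_arc41]): in the first case [x > 0 > y], in the second [x < 0 < y].
The sign of the flow thus alternates along [P] ([path_flow_sign]), and at two
internal vertices at even distance the third edges both take flow out of the
path or both bring flow in, by an amount between [1] and [2]. A single edge
joining these two vertices would have to carry flow out of both of its ends, or
into both, which is impossible modulo [5] since [(1, 2)] and [(-2, -1)] have
disjoint images in the circle ([no_even_chord]).

Real-valued lifts are kept throughout; the circle only enters through the
arcs. *)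

Set Implicit Arguments.
Unset Strict Implicit.

Import Order.TTheory GRing.Theory Num.Theory.

Local Open Scope classical_set_scope.
Local Open Scope ring_scope.

(** * Arcs of the circle, read on real lifts *)

(** Membership in the image on the circle of the interval [(lo, hi)], stated on
lifts so that linear arithmetic applies. *)
Definition lifts_in (R : realType) (lo hi x : R) : Prop :=
  exists n : int, lo < x - 5 * n%:~R < hi.

Lemma mod5B (R : realType) (x y : R) : mod5 (x - y) = mod5 x - mod5 y.
Proof. exact: (raddfB (\pi_(Quotient.quot (@fiveZ R : zmodClosed R)))%qT). Qed.

Lemma mod50 (R : realType) : mod5 (0 : R) = 0.
Proof. exact: (raddf0 (\pi_(Quotient.quot (@fiveZ R : zmodClosed R)))%qT). Qed.

HB.instance Definition _ (R : realType) :=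
  GRing.isZmodMorphism.Build R (circle R) (@mod5 R) (@mod5B R).

Lemma mod5_eqP (R : realType) (x y : R) :
  mod5 x = mod5 y <-> exists n : int, x = y + 5 * n%:~R.
Proof.
have -> : mod5 x = mod5 y <-> x - y \in @fiveZ R.
  by rewrite (Quotient.idealrBE (@fiveZ R : zmodClosed R)); split=> /eqP.
rewrite inE; split=> [/intrP[n En]|[n ->]].
  by exists n; lra.
by apply/intrP; exists n; lra.
Qed.

(** An arc shorter than the circle is the image of any interval that lifts its
two ends; choosing [(-1, 1)] as the lift of [(4, 1)] is what makes signs
meaningful below. *)
Lemma open_arcP (R : realType) (a b x : R) : a < b < a + 5 ->
  open_arc (mod5 a) (mod5 b) (mod5 x) <-> lifts_in a b x.
Proof.
move=> /andP[ab ba]; rewrite /open_arc; case: eqP => [|_].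
  move=> /mod5_eqP[n En]; exfalso.
  have n_gt : (-1 : int) < n by rewrite -(ltr_int R); lra.
  have n_lt : n < (0 : int) by rewrite -(ltr_int R); lra.
  by lia.
split=> [[s [y [t [/mod5_eqP[p ->] /mod5_eqP[q ->] /mod5_eqP[r ->]]]]]|].
  move=> ts /andP[sy yt].
  (* both (a, b) and (s, t) are shorter than 5, so a and b are lifted by the
     same multiple of 5 *)
  have pq : p = q.
    have : p < q + 1 by rewrite -(ltr_int R) intrD; lra.
    have : q < p + 1 by rewrite -(ltr_int R) intrD; lra.
    by lia.
  exists (p - r); rewrite intrB; move: sy yt; rewrite -pq => sy yt.
  by apply/andP; split; lra.
move=> [n /andP[an nb]]; exists a, (x - 5 * n%:~R), b; split=> //.
  by apply/mod5_eqP; exists (- n); rewrite intrN; lra.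
by apply/andP; split.
Qed.

Lemma arc14P (R : realType) (x : R) : arc14 (mod5 x) <-> lifts_in 1 4 x.
Proof. by apply: open_arcP; apply/andP; split; lra. Qed.

Lemma arc41P (R : realType) (x : R) : @arc41 R (mod5 x) <-> lifts_in (-1) 1 x.
Proof.
rewrite /arc41; have -> : mod5 (4 : R) = mod5 (-1).
  by apply/mod5_eqP; exists 1; lra.
by apply: open_arcP; apply/andP; split; lra.
Qed.

Lemma arc14N (R : realType) (x : R) : arc14 (mod5 x) -> arc14 (mod5 (- x)).
Proof.
move=> /arc14P[n /andP[n1 n4]]; apply/arc14P; exists (- n - 1).
by rewrite intrB intrN; apply/andP; split; lra.
Qed.

(** The sign rule at an internal vertex of the path: two numbers of absolute
value less than [1] differ by less than [2], so a difference that is more than [1]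
and less than [4] modulo [5] forces opposite signs. *)
Lemma arc14_sub_arc41 (R : realType) (x y : R) :
  @arc41 R (mod5 x) -> @arc41 R (mod5 y) -> arc14 (mod5 (x - y)) ->
     lifts_in 0 1 x /\ lifts_in (-1) 0 y /\ lifts_in 1 2 (x - y)
  \/ lifts_in (-1) 0 x /\ lifts_in 0 1 y /\ lifts_in (-2) (-1) (x - y).
Proof.
move=> /arc41P[p /andP[p1 p2]] /arc41P[q /andP[q1 q2]] /arc14P[n /andP[n1 n2]].
have [E|E] : n = p - q \/ n + 1 = p - q.
  have : n < p - q + 1 by rewrite -(ltr_int R) !intrD intrN; lra.
  have : p - q < n + 2 by rewrite -(ltr_int R) !intrD intrN; lra.
  by lia.
(* [n = p - q] is the case where the lifts differ by more than [1], and
   [n + 1 = p - q] the one where they differ by less than [-1]. *)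
- have {}E : (n%:~R : R) = p%:~R - q%:~R by rewrite -intrB -E.
  by left; split; [exists p|split; [exists q|exists n]]; apply/andP; split; lra.
- have {}E : (n%:~R : R) = p%:~R - q%:~R - 1 by rewrite -intrB -E intrD; lra.
  right; split; [exists p|split; [exists q|exists (n + 1)]];
    by rewrite ?intrD; apply/andP; split; lra.
Qed.

Lemma lifts_in_disjoint (R : realType) (a b c d x : R) :
  b <= c -> d <= a + 5 -> lifts_in a b x -> ~ lifts_in c d x.
Proof.
move=> bc da [p /andP[p1 p2]] [q /andP[q1 q2]].
have : q < p by rewrite -(ltr_int R); lra.
have : p < q + 1 by rewrite -(ltr_int R) intrD; lra.
by lia.
Qed.

Lemma lifts_inN (R : realType) (a b x : R) :
  lifts_in a b x -> lifts_in (- b) (- a) (- x).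
Proof.
by move=> [n /andP[an nb]]; exists (- n); rewrite intrN; apply/andP; split; lra.
Qed.

(** * Flows relative to the reference directions of the edges *)

(** A loop contributes nothing, since its two terms cancel. *)
Definition outflow (A : zmodType) (G : mgraph) (h : edge G -> A) (e : edge G)
    (v : vert G) : A :=
  h e *+ (src e == v) - h e *+ (tgt e == v).

Definition net_outflow (A : zmodType) (G : mgraph) (h : edge G -> A)
    (v : vert G) : A :=
  \sum_e outflow h e v.

(** Reversing an edge of the orientation amounts to negating its value, so every
flow can be read along the fixed directions from [src] to [tgt]. *)
Definition signed (A : zmodType) (G : mgraph) (o : orientation G)
    (f : edge G -> A) : edge G -> A :=
  fun e => if o e then - f e else f e.

Lemma is_flowP (A : zmodType) (G : mgraph) (o : orientation G)
    (f : edge G -> A) :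
  is_flow o f <-> forall v, net_outflow (signed o f) v = 0.
Proof.
have E v : net_outflow (signed o f) v =
    \sum_(e | edge_tail o e == v) f e - \sum_(e | edge_head o e == v) f e.
  rewrite (big_mkcond (fun e => edge_tail o e == v)).
  rewrite (big_mkcond (fun e => edge_head o e == v)) -sumrB.
  apply: eq_bigr => e _; rewrite /outflow /signed /edge_tail /edge_head.
  by case: (o e); rewrite -!mulrb ?mulNrn ?opprK // addrC.
split=> F v; first by rewrite E F subrr.
by apply/esym/eqP; rewrite -subr_eq0 -E F.
Qed.

Lemma outflow_joins (A : zmodType) (G : mgraph) (h : edge G -> A) e u v :
  joins e u v -> u != v -> outflow h e v = - outflow h e u.
Proof.
rewrite /outflow; move=> [] [-> ->] uv.
  by rewrite !eqxx (negPf uv) eq_sym (negPf uv) !mulr0n !mulr1n subr0 sub0r.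
by rewrite !eqxx (negPf uv) eq_sym (negPf uv) !mulr0n !mulr1n subr0 sub0r opprK.
Qed.

Lemma outflow_end (A : zmodType) (G : mgraph) (h : edge G -> A) e v :
  ((src e == v) + (tgt e == v))%N = 1%N ->
  outflow h e v = h e \/ outflow h e v = - h e.
Proof.
rewrite /outflow; case: (src e == v); case: (tgt e == v) => // _.
  by left; rewrite mulr0n subr0.
by right; rewrite mulr0n sub0r.
Qed.

Lemma sum_net_outflow (A : zmodType) (G : mgraph) (h : edge G -> A) :
  \sum_v net_outflow h v = 0.
Proof.
rewrite exchange_big /= big1 // => e _.
have pick (x : vert G) : \sum_v h e *+ (x == v) = h e.
  rewrite (bigD1 x) //= eqxx big1 ?addr0 // => v /negPf.
  by rewrite eq_sym => ->.
by rewrite sumrB !pick subrr.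
Qed.

Lemma net_outflow_mod5 (R : realType) (G : mgraph) (h : edge G -> R) v :
  net_outflow (fun e => mod5 (h e)) v = mod5 (net_outflow h v).
Proof.
rewrite /net_outflow raddf_sum; apply: eq_bigr => e _.
by rewrite /outflow raddfB !raddfMn.
Qed.

(** An isomorphism may exchange the two ends of an edge; the value is then
negated, and [arc14] is symmetric. *)
Lemma isomorphic_flow (R : realType) (G1 G2 : mgraph) (h : edge G2 -> R) :
  isomorphic G1 G2 -> (forall v, net_outflow h v = 0) ->
  (forall e, arc14 (mod5 (h e))) ->
  exists h1 : edge G1 -> R,
    (forall v, net_outflow h1 v = 0) /\ forall e, arc14 (mod5 (h1 e)).
Proof.
move=> [f [g [bij_f bij_g fg]]] h0 h14.
pose same e := (src (g e) == f (src e)) && (tgt (g e) == f (tgt e)).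
exists (fun e => if same e then h (g e) else - h (g e)); split=> [v|e]; last first.
  by case: ifP => _ //; apply: arc14N.
rewrite -(h0 (f v)) /net_outflow (reindex g) /=; last exact: onW_bij.
have injf := bij_inj bij_f.
apply: eq_bigr => e _; rewrite /outflow -!(inj_eq injf) /same.
case: (fg e) => -[-> ->]; first by rewrite !eqxx.
by case: ifP => [/andP[/eqP-> _]|_]; rewrite // !mulNrn opprK addrC.
Qed.

(** * From the replaced graph back to the base graph *)

(** Inner vertices of different generalised edges stay apart, so conservation at
such a vertex involves the edges of one generalised edge only. Equality is
taken in the disjoint union because [e] and [e'] may differ. *)
Lemma remb_inr (H : mgraph) (K : edge H -> gedge) (e e' : edge H)
    (u : vert (K e')) (w : inner_vert K e) :
  (remb u == inr (Tagged (inner_vert K) w)) =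
  (Tagged (fun e => vert (K e)) u == Tagged (fun e => vert (K e)) (val w)).
Proof.
have [E|nE] := eqVneq e' e; last first.
  rewrite -!tag_eqE /tag_eq /= (negPf nE) /remb; case: insub => [w'|] //.
  by apply/eqP => -[] E; rewrite E eqxx in nE.
subst e'; rewrite eq_Tagged /= /remb; case: insubP => [w' _ <-|] /=.
  by rewrite (inj_eq inr_inj) eq_Tagged /= val_eqE.
by move=> nin; apply/esym/eqP => uw; move: nin; rewrite uw (valP w).
Qed.

(** Only terminals are glued to vertices of [H]. At most one term is nonzero, the
terminals being distinct; the additive form, valid also when [e] is a loop of
[H], splits outflows at [v] into outflows at the two terminals. *)
Lemma remb_inl (H : mgraph) (K : edge H -> gedge) (e : edge H)
    (u : vert (K e)) (v : vert H) :
  (remb u == inl v) =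
  ((u == term1 (K e)) * (src e == v) + (u == term2 (K e)) * (tgt e == v))%N
    :> nat.
Proof.
have t12 := term_neq (K e); rewrite /remb; case: insubP => [w /andP[]|].
  by move=> /negPf u1 /negPf u2 _; rewrite u1 u2.
rewrite negb_and !negbK; case: (eqVneq u (term1 _)) => [-> _|_ /= ->] /=.
  by rewrite (negPf t12) (inj_eq inl_inj); case: eqP.
by rewrite (inj_eq inl_inj); case: eqP.
Qed.

(** Inside one generalised edge, conservation at the inner vertices leaves only
the two terminals unbalanced, by opposite amounts. This amount is the value to
put on the edge of [H], and also the value that a new edge between the
terminals must carry to restore balance, whence its membership in the
capacity. *)
Lemma contract_flow (R : realType) (H : mgraph) (K : edge H -> gedge)
    (h : edge (replace_edges K) -> R) :
  (forall v, net_outflow h v = 0) -> (forall e, arc14 (mod5 (h e))) ->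
  exists c : edge H -> R,
    (forall v, net_outflow c v = 0) /\
    forall e, open_capacity R (K e) (mod5 (c e)).
Proof.
move=> h0 h14.
pose hK e : edge (K e) -> R := fun k => h (Tagged (fun e => edge (K e)) k).
have split_h v : net_outflow h v = \sum_e \sum_(k : edge (K e))
    (hK e k *+ (remb (src k) == v) - hK e k *+ (remb (tgt k) == v)).
  by rewrite sig_big_dep /=; apply: eq_bigr => -[e k] _.
have inner e u : u != term1 (K e) -> u != term2 (K e) ->
    net_outflow (hK e) u = 0.
  move=> u1 u2; have u12 : (u != term1 (K e)) && (u != term2 (K e)) by rewrite u1.
  have := h0 (inr (Tagged (inner_vert K) (Sub u u12 : inner_vert K e))).
  rewrite split_h (bigD1 e) //= [X in _ + X]big1 ?addr0 => [|e' ne].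
    move=> E0; rewrite -[RHS]E0; apply: eq_bigr => k _.
    by rewrite !remb_inr !eq_Tagged.
  apply: big1 => k _; rewrite !remb_inr -!tag_eqE /tag_eq /= (negPf ne).
  by rewrite subrr.
pose c e := net_outflow (hK e) (term1 (K e)).
have outflow2 e : net_outflow (hK e) (term2 (K e)) = - c e.
  have t12 := term_neq (K e).
  have := sum_net_outflow (hK e).
  rewrite (bigD1 (term1 (K e))) //= (bigD1 (term2 (K e))) 1?eq_sym //=.
  rewrite big1 ?addr0 => [/eqP|u /andP[]]; last exact: inner.
  by rewrite addrC addr_eq0 => /eqP.
exists c; split=> [v|e].
  rewrite -(h0 (inl v)) split_h; apply: eq_bigr => e _.
  rewrite /outflow -mulNrn -outflow2 /c /net_outflow -!sumrMnl -big_split /=.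
  apply: eq_bigr => k _; rewrite /outflow !remb_inl !mulrnDr !mulrnA.
  by rewrite !mulrnBl; lra.
(* The new edge is directed from the second terminal to the first, so that it
   returns the amount [c e]. *)
exists (fun x => x == None).
exists (fun x => if x is Some k then mod5 (hK e k) else mod5 (c e)).
split=> [|k|//]; last exact: h14.
apply/is_flowP => u; rewrite /net_outflow (bigD1 None) //=.
have -> F : \sum_(x : option (edge (K e)) | x != None) F x =
    \sum_(k : edge (K e)) F (Some k) :> circle R.
  rewrite (reindex_omap Some id) /=; last by case.
  by apply: eq_bigl => k; rewrite eqxx.
rewrite -[X in _ + X]/(net_outflow (fun k => mod5 (hK e k)) u).
rewrite net_outflow_mod5.
rewrite /outflow /signed /= !mulNrn opprK.
have t12 := term_neq (K e).
have [<-|u1] := eqVneq (term1 (K e)) u.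
  by rewrite eq_sym (negPf t12) mulr1n mulr0n addr0 addNr.
have [<-|u2] := eqVneq (term2 (K e)) u.
  by rewrite outflow2 raddfN /= mulr0n mulr1n oppr0 add0r subrr.
by rewrite inner 1?eq_sym // mod50 !mulr0n oppr0 !addr0.
Qed.

(** * Signs alternate along a path of small edges *)

Definition sign_lift (R : realType) (s : bool) (x : R) : Prop :=
  if s then lifts_in 0 1 x else lifts_in (-1) 0 x.

Definition sign_lift2 (R : realType) (s : bool) (x : R) : Prop :=
  if s then lifts_in 1 2 x else lifts_in (-2) (-1) x.

Lemma sign_lift_step (R : realType) (s : bool) (x y : R) :
  @arc41 R (mod5 x) -> @arc41 R (mod5 y) -> arc14 (mod5 (x - y)) ->
  sign_lift s x -> sign_lift (~~ s) y /\ sign_lift2 s (x - y).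
Proof.
have disj : lifts_in (-1) 0 x -> ~ lifts_in 0 1 x.
  by apply: lifts_in_disjoint; lra.
move=> x41 y41 /(arc14_sub_arc41 x41 y41)[|] [xs [ys ds]]; case: s => //= sx.
  by case: (disj sx).
by case: (disj xs).
Qed.

(** Counting edge ends: two edges use two of the three ends at [v], so exactly
one further edge meets [v], and it is not a loop. *)
Lemma cubic_net_outflow (A : zmodType) (G : mgraph) (h : edge G -> A)
    (v : vert G) (a b : edge G) :
  degree v = 3%N -> a != b ->
  ((src a == v) + (tgt a == v))%N = 1%N ->
  ((src b == v) + (tgt b == v))%N = 1%N ->
  exists g, [/\ g != a, g != b, ((src g == v) + (tgt g == v))%N = 1%N,
    forall e, e != a -> e != b -> incident e v -> e = g &
    net_outflow h v = outflow h a v + outflow h b v + outflow h g v].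
Proof.
move=> d3 ab a1 b1; have ba : b != a by rewrite eq_sym.
have /eqP : (\sum_(e | (e != a) && (e != b)) ((src e == v) + (tgt e == v)) = 1)%N.
  have : (\sum_e ((src e == v) + (tgt e == v)) = 3)%N.
    rewrite -d3 /degree -!sum1dep_card big_split /=.
    by congr addn; rewrite [RHS]big_mkcond; apply: eq_bigr => e _; case: eqP.
  rewrite (bigD1 a) //= (bigD1 b) //= a1 b1.
  by move=> [].
move=> /sum_nat_eq1[g [/andP[ga gb] g1 others]].
have noend e : e != a -> e != b -> e != g -> (src e != v) && (tgt e != v).
  move=> ea eb eg; have := others e eg; rewrite ea eb => /(_ isT).
  by case: eqP; case: eqP.
exists g; split=> // [e ea eb ev|].
  apply/eqP/negPn/negP => eg; have /andP[/eqP s /eqP t] := noend e ea eb eg.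
  by case: ev.
rewrite /net_outflow (bigD1 a) //= (bigD1 b) //= (bigD1 g) ?ga //=.
rewrite big1 ?addr0 ?addrA // => e /andP[/andP[ea eb] eg].
have /andP[/negPf s /negPf t] := noend e ea eb eg.
by rewrite /outflow s t subrr.
Qed.

Lemma joins_ends (G : mgraph) (e : edge G) u v : joins e u v -> u != v ->
  ((src e == u) + (tgt e == u))%N = 1%N /\ ((src e == v) + (tgt e == v))%N = 1%N.
Proof.
by case=> -[-> ->] uv; rewrite !eqxx (negPf uv) eq_sym (negPf uv).
Qed.

(** The amount carried by the [a]-th path edge in the direction of the path. *)
Definition path_flow (R : realType) (H : mgraph) (P : gpath H)
    (c : edge H -> R) (a : 'I_(plen P)) : R :=
  outflow c (pedge P a) (pvert P (widen_ord (leqnSn (plen P)) a)).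

Section PathFlow.
Variables (R : realType) (H : mgraph) (P : gpath H) (c : edge H -> R).
Hypothesis c_flow : forall v, net_outflow c v = 0.
Hypothesis c_path : forall a, @arc41 R (mod5 (c (pedge P a))).
Hypothesis cubic : forall k, internal P k -> degree (pvert P k) = 3%N.
Hypothesis c_side : forall k e, internal P k -> ~ in_path P e ->
  incident e (pvert P k) -> arc14 (mod5 (c e)).

Lemma pedge_ends (a : 'I_(plen P)) :
  let u := pvert P (widen_ord (leqnSn (plen P)) a) in
  let v := pvert P (lift ord0 a) in
  [/\ u != v, joins (pedge P a) u v,
      ((src (pedge P a) == u) + (tgt (pedge P a) == u))%N = 1%N &
      ((src (pedge P a) == v) + (tgt (pedge P a) == v))%N = 1%N].
Proof.
move=> u v; have uv : u != v.
  rewrite (inj_eq (@pvert_inj _ P)); apply/eqP => /(congr1 val) /=.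
  by rewrite /bump /=; lia.
have j := pedge_joins a; have [] := joins_ends j uv; by split.
Qed.

Lemma path_flow_arc41 (a : 'I_(plen P)) : @arc41 R (mod5 (path_flow c a)).
Proof.
have [_ _ /(outflow_end c) + _] := pedge_ends a.
rewrite /path_flow => -[->|->]; first exact: c_path.
by have /arc41P/lifts_inN := c_path a; rewrite opprK => /arc41P.
Qed.

(** Conservation at an internal vertex [k] of the path: the unique edge leaving
the path there carries the drop of the path flow. *)
Lemma side_edge (k : 'I_(plen P).+1) (a b : 'I_(plen P)) :
  a.+1 = k :> nat -> b = k :> nat ->
  exists g, [/\ forall e, ~ in_path P e -> incident e (pvert P k) -> e = g,
    outflow c g (pvert P k) = path_flow c a - path_flow c b &
    arc14 (mod5 (path_flow c a - path_flow c b))].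
Proof.
move=> ak bk; have kint : internal P k.
  by rewrite /internal -ak /= ak -bk.
have ka : lift ord0 a = k by apply: val_inj.
have kb : widen_ord (leqnSn (plen P)) b = k by apply: val_inj.
have [uva ja _ a1] := pedge_ends a; rewrite ka in uva ja a1.
have [uvb jb b1 _] := pedge_ends b; rewrite kb in uvb jb b1.
have on_path m : incident (pedge P m) (pvert P k) -> m = a \/ m = b.
  have [_ jm _ _] := pedge_ends m; rewrite /incident => inc.
  have [|] : widen_ord (leqnSn (plen P)) m = k \/ lift ord0 m = k.
    by case: jm inc => -[-> ->] [] /(@pvert_inj _ P); auto.
  - by move=> mk; right; apply: val_inj; rewrite /= bk -mk.
  - by move=> mk; left; apply: val_inj; move: ak; rewrite -mk /= => -[].
have ab : pedge P a != pedge P b.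
  apply/eqP => E; move: ja jb; rewrite E /joins.
  case=> [] [-> ->] [] [] /(@pvert_inj _ P)/(congr1 val) +
    /(@pvert_inj _ P)/(congr1 val); rewrite /= /bump /=; move: ak bk; lia.
have [g [ga gb g1 uniq_g bal]] := cubic_net_outflow c (cubic kint) ab a1 b1.
have gP : ~ in_path P g.
  case=> m Em; have : incident (pedge P m) (pvert P k).
    rewrite Em /incident.
    by move: g1; case: eqP => [?|_]; [left|case: eqP => // ?; right].
  by move/on_path => -[] E; rewrite -Em E eqxx in ga gb.
have Eg : outflow c g (pvert P k) = path_flow c a - path_flow c b.
  move: bal; rewrite c_flow (outflow_joins c ja uva) /path_flow kb; lra.
exists g; split=> // [e eP|].
  by apply: uniq_g; apply/eqP => E; apply: eP; rewrite E; [exists a|exists b].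
rewrite -Eg; have g14 : arc14 (mod5 (c g)).
  apply: c_side kint gP _; move: g1; rewrite /incident.
  by case: eqP => [?|_]; [left|case: eqP => // ?; right].
by case: (outflow_end c g1) => -> //; apply: arc14N.
Qed.

(** All vertices strictly between two path edges are internal, and the sign
changes at each of them. *)
Lemma path_flow_sign (s : bool) (n : nat) (a b : 'I_(plen P)) :
  b = (a + n)%N :> nat -> sign_lift s (path_flow c a) ->
  sign_lift (s (+) odd n) (path_flow c b).
Proof.
elim: n b => [|n IHn] b; first by rewrite addn0 addbF => /val_inj->.
rewrite addnS => bE sa.
have m_lt : (a + n < plen P)%N by rewrite -bE ltnW.
pose m := Ordinal m_lt.
have [g [_ _ d14]] :=
  @side_edge (widen_ord (leqnSn (plen P)) b) m b (esym bE) erefl.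
have sm : sign_lift (s (+) odd n) (path_flow c m) by apply: IHn.
have [] := sign_lift_step (path_flow_arc41 m) (path_flow_arc41 b) d14 sm.
by rewrite oddS addbN.
Qed.

(** The chord is the third edge at both of its ends. The path flow drops there by
amounts of the same sign, whereas the outflows of one edge at its two ends are
opposite. *)
Lemma no_even_chord (i j : 'I_(plen P).+1) (e : edge H) :
  internal P i -> internal P j -> (i < j)%N -> ~~ odd (j - i) ->
  ~ in_path P e -> ~ joins e (pvert P i) (pvert P j).
Proof.
move=> /andP[i0 iP] /andP[j0 jP] ij even_ij eP e_ij.
have pred_lt (k : nat) : (0 < k -> k < plen P -> k.-1 < plen P)%N by lia.
pose a := Ordinal (pred_lt i i0 iP); pose a' := Ordinal (pred_lt j j0 jP).
have [g [gE gi d14]] := @side_edge i a (Ordinal iP) (prednK i0) erefl.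
have [g' [gE' gj d14']] := @side_edge j a' (Ordinal jP) (prednK j0) erefl.
have ei : incident e (pvert P i) by case: e_ij => -[? ?]; [left|right].
have ej : incident e (pvert P j) by case: e_ij => -[? ?]; [right|left].
rewrite -(gE e eP ei) in gi; rewrite -(gE' e eP ej) in gj.
have vij : pvert P i != pvert P j.
  by rewrite (inj_eq (@pvert_inj _ P)) neq_ltn ij.
have opp := outflow_joins c e_ij vij; rewrite gi gj in opp.
have [s sa] : exists s, sign_lift s (path_flow c a).
  have [[sa _]|[sa _]] := arc14_sub_arc41 (path_flow_arc41 _)
    (path_flow_arc41 _) d14; by [exists true|exists false].
have sa' : sign_lift s (path_flow c a').
  rewrite -[s]addbF -(negPf even_ij); apply: path_flow_sign sa => /=; lia.
have [_] := sign_lift_step (path_flow_arc41 _) (path_flow_arc41 _) d14 sa.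
have [_] := sign_lift_step (path_flow_arc41 _) (path_flow_arc41 _) d14' sa'.
rewrite opp; case: s {sa sa'} => /= /lifts_inN; rewrite !opprK.
  by apply: lifts_in_disjoint; lra.
by move=> pos neg; move: neg pos; apply: lifts_in_disjoint; lra.
Qed.

End PathFlow.

(** * Flows with values in (1, 4) *)

(** The strict inequality [r - 1 < 4] leaves room for a scaling that makes the
lower bound strict as well. *)
Lemma circular_flow_lt5 (R : realType) (G : mgraph) (r : R) :
  2 <= r < 5 -> has_circular_nzflow G r ->
  exists h : edge G -> R,
    (forall v, net_outflow h v = 0) /\ forall e, arc14 (mod5 (h e)).
Proof.
move=> /andP[r2 r5] [o [f [/is_flowP flow bnd]]].
pose w := 4 / (r - 1); have wr : w * (r - 1) = 4 by rewrite divfK //; lra.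
have w1 : 1 < w by rewrite ltr_pdivlMr; lra.
(* Any factor strictly between [1] and [w] works. *)
pose lam := (1 + w) / 2.
exists (fun e => lam * signed o f e); split=> [v|e].
  rewrite -[RHS](mulr0 lam) -(flow v) /net_outflow mulr_sumr.
  by apply: eq_bigr => e _; rewrite /outflow mulrBr !mulrnAr.
have f14 : arc14 (mod5 (lam * f e)).
  have /andP[f1 fr] := bnd e; apply/arc14P; exists 0.
  rewrite mulr0 subr0.
  have : lam * 1 <= lam * f e by rewrite ler_wpM2l // /lam; lra.
  have : lam * f e <= lam * (r - 1) by rewrite ler_wpM2l // /lam; lra.
  by rewrite /lam => ? ?; apply/andP; split; nra.
by rewrite /signed; case: (o e); rewrite ?mulrN //; apply: arc14N.
Qed.

Unset Implicit Arguments.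

Theorem corollary3p6 (R : realType) (H : mgraph)
    (sigma : edge H -> set (circle R)) (P : gpath H) :
  (forall e, SI5 (sigma e)) ->
  (forall e, in_path P e -> sigma e = @arc41 R) ->
  (forall i, internal P i -> degree (pvert P i) = 3%N) ->
  (forall i e, internal P i -> ~ in_path P e -> incident e (pvert P i) ->
     sigma e `<=` @arc14 R) ->
  (exists (i j : 'I_(plen P).+1) (e : edge H),
     [/\ internal P i, internal P j, (i < j)%N & ~~ odd (j - i)] /\
     (~ in_path P e /\ joins e (pvert P i) (pvert P j))) ->
  forall G, replacement_family sigma G -> (5%:E <= circular_flow_number R G)%E.
Proof.
move=> _ path41 cubic side14 [i [j [e [[int_i int_j ij even] [eP e_ij]]]]] G.
move=> [K KE isoG]; apply: le_ereal_inf_tmp => _ [r [r2 flow_r] <-].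
rewrite lee_fin leNgt; apply/negP => r5.
have [|hG [hG0 hG14]] := circular_flow_lt5 _ flow_r; first by rewrite r2.
have [h [h0 h14]] := isomorphic_flow isoG hG0 hG14.
have [c [c0 cK]] := contract_flow h0 h14.
apply: (@no_even_chord R H P c) e_ij => // [a|k g int_k gP gk].
  by rewrite -(path41 (pedge P a)); [rewrite -KE|exists a].
by apply: side14 int_k gP gk _ _; rewrite -KE.
Qed.
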